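(* Let $M$ be a left $R$-module which is projective in $\sigma[M]$. The following conditions are equivalent: (a) $Spec(M)$ is a normal space. (b) The frame $SP(M)$ is normal.
   Context: $R$ is an associative ring with identity; modules are unital left $R$-modules. A submodule $N\leq M$ is fully invariant if $f(N)\subseteq N$ for all $f\in\mathrm{End}_R(M)$; $\Lambda^{fi}(M)$ is the lattice of fully invariant submodules of $M$ ordered by inclusion. $\sigma[M]$ is the full subcategory of $R$-Mod of all modules that embed in a quotient of some direct sum $M^{(X)}$. $M$ is $N$-projective if for every epimorphism $\rho\colon N\to X$ and every homomorphism $\alpha\colon M\to X$ there is $\beta\colon M\to N$ with $\rho\beta=\alpha$; $M$ is projective in $\sigma[M]$ if it is $N$-projective for every $N\in\sigma[M]$. For $N,L\leq M$ put $N_ML=\sum\{f(N)\mid f\in\mathrm{Hom}_R(M,L)\}$. $Spec(M)$ is the set of proper $P\in\Lambda^{fi}(M)$ such that $N_ML\leq P$ with $N,L\in\Lambda^{fi}(M)$ implies $N\leq P$ or $L\leq P$, with the topology whose closed sets are $\{P\in Spec(M)\mid N\leq P\}$, $N\in\Lambda^{fi}(M)$. A proper fully invariant submodule $N$ of $M$ is semiprime if for every $L\in\Lambda^{fi}(M)$, $L_ML\leq N$ implies $L\leq N$. $SP(M)=\{M\}\cup\{\text{semiprime submodules of }M\}$, ordered by inclusion; when $M$ is projective in $\sigma[M]$ this is a spatial frame, in which the meet is intersection. A frame is normal if for all $a,b$ with $a\vee b=1$ there exist $a',b'$ with $a\vee b'=1=a'\vee b$ and $a'\wedge b'=0$ (joins,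 $0$ and $1$ taken in the frame). A topological space is normal if any two disjoint closed subsets are contained respectively in disjoint open subsets (no $T_1$ assumption). *)

(* Defs.v *)
From HB Require Import structures.
From mathcomp Require Import all_boot all_order all_algebra.
From mathcomp Require Import all_classical.
From mathcomp Require Import topology.

Set Implicit Arguments.
Unset Strict Implicit.
Unset Printing Implicit Defensive.

Import Order.TTheory GRing.Theory.
Local Open Scope classical_set_scope.
Local Open Scope ring_scope.

(* [pzRingType] is the class of associative rings with identity; the zero ring
   is not excluded. *)

Section DirectSum.
Context (R : pzRingType) (M : lmodType R) (X : Type).

Definition fin_supp : {pred X -> M} :=
  fun f => `[< finite_set [set i | f i <> 0] >].

Fact fin_supp_submod : submod_closed fin_supp.
Proof.
split=> [|a f g /asboolP ff /asboolP fg]; apply/asboolP.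
  by rewrite (_ : [set _ | _] = set0)// -subset0 => i /=.
apply: (@sub_finite_set _ _ ([set i | f i <> 0] `|` [set i | g i <> 0])).
  move=> i /= fgi; have [fi0|] := pselect (f i = 0); last by left.
  by right=> gi0; apply: fgi; rewrite fctE /= gi0 addr0 -[LHS]/(a *: f i) fi0 scaler0.
by rewrite finite_setU.
Qed.

HB.instance Definition _ :=
  GRing.isSubmodClosed.Build R (X -> M) fin_supp fin_supp_submod.

(* The direct sum M^(X). *)
Record direct_sum := DirectSum {
  direct_sum_fun :> X -> M; _ : direct_sum_fun \in fin_supp }.
HB.instance Definition _ := [isSub for direct_sum_fun].
HB.instance Definition _ := [Choice of direct_sum by <:].
HB.instance Definition _ := [SubChoice_isSubLmodule of direct_sum by <:].

End DirectSum.

Section Modules.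
Context (R : pzRingType).

(* N embeds in a quotient Q of some M^(X), the quotient being presented by a
   surjective homomorphism onto Q. *)
Definition in_sigma (M N : lmodType R) : Prop :=
  exists (X : Type) (Q : lmodType R)
    (p : {linear direct_sum M X -> Q}) (i : {linear N -> Q}),
    set_surj setT setT p /\ injective i.

(* Epimorphisms of modules are the surjective homomorphisms. *)
Definition relatively_projective (M N : lmodType R) : Prop :=
  forall (X : lmodType R) (rho : {linear N -> X}) (alpha : {linear M -> X}),
    set_surj setT setT rho ->
    exists beta : {linear M -> N}, rho \o beta =1 alpha.

Definition projective_in_sigma (M : lmodType R) : Prop :=
  forall N : lmodType R, in_sigma M N -> relatively_projective M N.

Context (M : lmodType R).
Implicit Types N L P : set M.

Definition submodule N : Prop :=
  N 0 /\ forall (a : R) x y, N x -> N y -> N (a *: x + y).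

Definition fully_invariant N : Prop :=
  submodule N /\ forall f : {linear M -> M}, f @` N `<=` N.

(* The product N_M L: the sum of the submodules f(N) for f in Hom_R(M, L), the
   latter being identified with the endomorphisms of M with range in L. *)
Definition mprod N L : set M :=
  smallest submodule
    (\bigcup_(f in [set f : {linear M -> M} | range f `<=` L]) f @` N).

Definition prime_submodule P : Prop :=
  [/\ fully_invariant P, P <> setT &
      forall N L, fully_invariant N -> fully_invariant L ->
        mprod N L `<=` P -> N `<=` P \/ L `<=` P].

Definition semiprime_submodule N : Prop :=
  [/\ fully_invariant N, N <> setT &
      forall L, fully_invariant L -> mprod L L `<=` N -> L `<=` N].

Definition SP_set : set (set M) :=
  [set N | N = setT \/ semiprime_submodule N].

Record Spec := MkSpec {
  Spec_val :> set M; _ : Spec_val \in [set P | prime_submodule P] }.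
HB.instance Definition _ := [isSub for Spec_val].
HB.instance Definition _ := [Choice of Spec by <:].

Record SP := MkSP { SP_val :> set M; _ : SP_val \in SP_set }.
HB.instance Definition _ := [isSub for SP_val].
HB.instance Definition _ := [Choice of SP by <:].

End Modules.

Section Lemmas.
Context (R : pzRingType) (M : lmodType R).
Implicit Types N L P : set M.

Lemma submodule_smallest (C : set (set M)) N :
  C `<=` @submodule R M -> submodule (smallest C N).
Proof.
move=> Csub; split=> [A [/Csub[A0 _] _]//|a x y xN yN A [CA NA]].
by have [_] := Csub _ CA; apply; [exact: xN|exact: yN].
Qed.

Lemma fully_invariant_setT : fully_invariant [set: M].
Proof. by []. Qed.

Lemma fully_invariant_bigcap (I : Type) (D : set I) (F : I -> set M) :
  (forall i, D i -> fully_invariant (F i)) -> fully_invariant (\bigcap_(i in D) F i).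
Proof.
move=> Ffi; split; first split.
- by move=> i /Ffi[[]].
- by move=> a x y Fx Fy i Di; have [[_ +] _] := Ffi i Di; apply; [exact: Fx|exact: Fy].
- move=> f _ [x Fx <-] i Di; have [_ +] := Ffi i Di.
  by apply; exists x => //; exact: Fx.
Qed.

Lemma submodule_preim N (f : {linear M -> M}) :
  submodule N -> submodule (f @^-1` N).
Proof.
move=> [N0 NZD]; split=> [|a x y] /=; first by rewrite linear0.
by rewrite linearP; exact: NZD.
Qed.

Lemma fully_invariant_mprod N L : fully_invariant L -> fully_invariant (mprod N L).
Proof.
move=> [_ Lf]; split; first exact: submodule_smallest.
move=> g _ [x xNL <-] A [sA NA].
apply: (xNL (g @^-1` A)); split; first exact: submodule_preim.
move=> _ [f /= fL [y Ny <-]] /=; apply: NA.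
exists (g \o f : {linear M -> M}); last by exists y.
by move=> _ [z _ <-]; apply: (Lf g); exists (f z) => //; apply: fL; exists z.
Qed.

Lemma mprod_subl N L : fully_invariant N -> mprod N L `<=` N.
Proof.
move=> [sN Nf] x; apply; split=> // y [f _ fN]; exact: (Nf f).
Qed.

Lemma mprod_subr N L : submodule L -> mprod N L `<=` L.
Proof.
move=> sL x; apply; split=> // _ [f fL [y _ <-]]; apply: fL.
by exists y.
Qed.

Lemma fully_invariant_smallest N : fully_invariant (smallest (@fully_invariant R M) N).
Proof. by apply: fully_invariant_bigcap => A [fA _]; exact: fA. Qed.

Lemma SP_bigcap (D : set (set M)) : D `<=` @SP_set R M ->
  SP_set (\bigcap_(N in D) N).
Proof.
move=> DSP; have [->|DT] := pselect (\bigcap_(N in D) N = setT); first by left.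
right; split=> //.
- apply: fully_invariant_bigcap => N /DSP[->|[fN _ _]]; [exact: fully_invariant_setT|exact: fN].
- move=> L fL LN x Lx N DN; have [->//|[_ _]] := DSP _ DN.
  by move=> /(_ L fL); apply=> // y /LN; exact.
Qed.

Lemma SP_setT : SP_set [set: M]. Proof. by left. Qed.

Lemma SP_smallest N : SP_set (smallest (@SP_set R M) N).
Proof. by apply: SP_bigcap => A [SA _]; exact: SA. Qed.

End Lemmas.

Section SpecTopology.
Context (R : pzRingType) (M : lmodType R).

Definition Spec_V (N : set M) : set (Spec M) := [set P | N `<=` val P].

Definition Spec_open (U : set (Spec M)) : Prop :=
  exists2 N, fully_invariant N & ~` U = Spec_V N.

Fact Spec_openT : Spec_open setT.
Proof.
exists setT; first exact: fully_invariant_setT.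
rewrite setCT; apply/esym; rewrite -subset0 => -[P /= Pp] /= TP.
by have /set_mem[_ + _] := Pp; apply; apply/seteqP; split.
Qed.

Fact Spec_openI : setI_closed Spec_open.
Proof.
move=> U W [N fN UN] [L fL WL]; exists (mprod N L).
  exact: fully_invariant_mprod.
rewrite setCI UN WL; apply/seteqP; split=> [P [NP|LP]|[P Pp] /=].
- by apply: subset_trans NP; exact: mprod_subl.
- by apply: subset_trans LP; apply: mprod_subr; case: fL.
- by have /set_mem[_ _ pP] := Pp => /(pP _ _ fN fL).
Qed.

Fact Spec_open_bigU (I : Type) (f : I -> set (Spec M)) :
  (forall i, Spec_open (f i)) -> Spec_open (\bigcup_i f i).
Proof.
move=> fo.
have /choice[g gP] i : exists N, fully_invariant N /\ ~` f i = Spec_V N.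
  by have [N] := fo i; exists N.
exists (smallest (@fully_invariant R M) (\bigcup_i g i)).
  exact: fully_invariant_smallest.
rewrite setC_bigcup; apply/seteqP; split=> [P fP x|P NP i _].
  apply; split; first by have /set_mem[] := valP P.
  by move=> y [i _]; have := fP i Logic.I; rewrite (gP i).2 => /(_ y).
rewrite (gP i).2 => x Nx; apply: NP => A [_]; apply.
by exists i.
Qed.

HB.instance Definition _ :=
  isOpenTopological.Build (Spec M) Spec_openT Spec_openI Spec_open_bigU.

Lemma Spec_closedP (C : set (Spec M)) :
  closed C <-> exists2 N, fully_invariant N & C = Spec_V N.
Proof.
rewrite -openC -[open _]/(Spec_open (~` C)) /Spec_open setCK.
by [].
Qed.

End SpecTopology.

Section SPLattice.
Context (R : pzRingType) (M : lmodType R).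

HB.instance Definition _ := [SubChoice_isSubPOrder of SP M by <: with set_display].

Implicit Types N L K : SP M.

Lemma SP_leP N L : reflect (N `<=` L) (N <= L)%O.
Proof. by rewrite leEsub; exact: asboolP. Qed.

(* SP(M) is closed under arbitrary intersections of submodules of M, so it is a
   bounded lattice for every M; the join is the least member of SP(M) above both
   arguments, not their sum.  Projectivity is only needed for distributivity. *)
Definition SP_bot : SP M := MkSP (mem_set (SP_smallest set0)).

Definition SP_top : SP M := MkSP (mem_set (SP_setT M)).

Fact SP_setI N L : SP_set (N `&` L).
Proof.
have -> : N `&` L = \bigcap_(A in [set (N : set M); (L : set M)]) A.
  by rewrite bigcap_setU !bigcap_set1.
by apply: SP_bigcap => _ [->|->]; apply: set_mem; exact: valP.
Qed.

Definition SP_meet N L : SP M := MkSP (mem_set (SP_setI N L)).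

Definition SP_join N L : SP M := MkSP (mem_set (SP_smallest (N `|` L))).

Fact SP_bot_le N : (SP_bot <= N)%O.
Proof. by apply/SP_leP => x; apply; split; [exact/set_mem/(valP N)|]. Qed.

Fact SP_le_top N : (N <= SP_top)%O.
Proof. exact/SP_leP. Qed.

Fact SP_lexI K N L : (K <= SP_meet N L)%O = (K <= N)%O && (K <= L)%O.
Proof.
apply/SP_leP/andP => [|[/SP_leP KN /SP_leP KL]]; rewrite subsetI //.
by move=> [KN KL]; split; apply/SP_leP.
Qed.

Fact SP_leUx N L K : (SP_join N L <= K)%O = (N <= K)%O && (L <= K)%O.
Proof.
apply/SP_leP/andP => [NLK|[/SP_leP NK /SP_leP LK] x].
  by split; apply/SP_leP => x Nx; apply: NLK => A [_]; apply; [left|right].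
by apply; split; [exact/set_mem/(valP K)|rewrite subUset].
Qed.

HB.instance Definition _ :=
  Order.POrder_isMeetSemilattice.Build _ (SP M) SP_lexI.
HB.instance Definition _ :=
  Order.POrder_isJoinSemilattice.Build _ (SP M) SP_leUx.
HB.instance Definition _ := Order.hasBottom.Build _ (SP M) SP_bot_le.
HB.instance Definition _ := Order.hasTop.Build _ (SP M) SP_le_top.

End SPLattice.

(* Normality of a frame only involves its finite meets and joins. *)
Definition normal_frame d (F : tbLatticeType d) : Prop :=
  forall a b : F, (a `|` b = \top)%O ->
    exists a' b' : F,
      [/\ (a `|` b' = \top)%O, (a' `|` b = \top)%O & (a' `&` b' = \bot)%O].

(* The library states [normal_space] through neighbourhoods; it is the usual
   separation of disjoint closed sets by disjoint open sets. *)
Lemma normal_space_openP (T : topologicalType) : normal_space T <->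
  forall A B : set T, closed A -> closed B -> A `&` B = set0 ->
  exists U V, [/\ open U, open V, A `<=` U, B `<=` V & U `&` V = set0].
Proof.
split=> [nT A B cA cB AB0|sepT A cA C].
  have /(nT A cA)[D /set_nbhsP[U [oU AU UD]] DB] : set_nbhs A (~` B).
    apply/set_nbhsP; exists (~` B); split=> //; first exact: closed_openC.
    exact/disjoints_subset.
  exists U, (~` closure D); split=> //.
  - by apply: closed_openC; exact: closed_closure.
  - by apply: subsetCr => x /DB.
  - by apply/disjoints_subset; rewrite setCK => x /UD /subset_closure.
move=> /set_nbhsP[U [oU AU UC]].
have [|V [W [oV oW AV UW VW0]]] := sepT A (~` U) cA (open_closedC oU).
  by apply/disjoints_subset; rewrite setCK.
exists V; first by apply/set_nbhsP; exists V; split.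
move=> x Vx; apply: UC; apply: contrapT => /UW Wx.
suff /(_ x Vx) : closure V `<=` ~` W by [].
have /closure_id -> := open_closedC oW.
by apply: closureS; exact/disjoints_subset.
Qed.

(* Main.v *)
Require Import Defs.
From HB Require Import structures.
From mathcomp Require Import all_boot all_order all_algebra.
From mathcomp Require Import all_classical.
From mathcomp Require Import topology.

Set Implicit Arguments.
Unset Strict Implicit.
Unset Printing Implicit Defensive.

Import Order.TTheory GRing.Theory.
Local Open Scope classical_set_scope.
Local Open Scope ring_scope.

(** Sending a member [N] of [SP M] to the closed set [Spec_V N] of primes above
    it turns the lattice [SP M] upside down into the lattice of closed subsets
    of [Spec M]: joins become intersections, meets become unions, [\top] becomes
    the empty set and [\bot] the whole space.  Every closed set arises, because
    primes are themselves members of [SP M], so the primes above a fully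
    invariant [N] are also those above the least member of [SP M] containing
    [N].  Once this map is known to be injective, normality of the frame is
    normality of the space read through complements: [a `|` b' = \top] says that
    [Spec_V a] lies in the open complement of [Spec_V b'], and
    [a' `&` b' = \bot] says that the complements of [Spec_V a'] and [Spec_V b']
    are disjoint.

    Injectivity ([Spec_V_inj]) is where projectivity enters: it says that a
    semiprime submodule [N] is the intersection of the primes above it
    ([semiprime_prime_separation]).  Given [x] outside [N], semiprimeness yields
    a sequence [x_0 = x, x_1, ...] outside [N] in which [x_(n+1)] belongs to the
    square of the fully invariant submodule generated by [x_n].  By Zorn's lemma
    there is a fully invariant [P] containing [N] and maximal among those missing
    all [x_n].  If [A] and [B] are not below [P], then [A + P] and [B + P] both
    contain [x_k] for some common [k], so [x_(k+1)] lies in the product of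
    [A + P] and [B + P].  That product would be contained in [P] if the product
    of [A] and [B] were ([mprod_sum_sub]); hence [P] is prime.

    The inclusion [mprod_sum_sub] needs additivity of the product in its second
    argument: a homomorphism from [M] to [B + P] has to be a sum of one to [B]
    and one to [P] ([range_sum_split]).  Such a decomposition is a lifting along
    the addition epimorphism from [B x P] to [B + P], and it exists because
    [B x P] embeds in [M^(2)] and so belongs to the category sigma[M]. *)

(** * Submodules as modules *)

Section SubmoduleAsModule.
Context (R : pzRingType) (M : lmodType R) (A : set M) (sA : submodule A).

(** Indexing the carrier by the proof that [A] is a submodule lets canonical
    inference recover this proof from the predicate alone. *)
Definition carrier of submodule A : {pred M} := fun x => `[< A x >].

Fact carrier_submod : submod_closed (carrier sA).
Proof.
case: (sA) => A0 AZD; split=> [|a x y /asboolP Ax /asboolP Ay]; apply/asboolP.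
  exact: A0.
exact: AZD.
Qed.

HB.instance Definition _ :=
  GRing.isSubmodClosed.Build R M (carrier sA) carrier_submod.

Record submodule_type := SubmoduleElt {
  submodule_val :> M; _ : submodule_val \in carrier sA }.
HB.instance Definition _ := [isSub for submodule_val].
HB.instance Definition _ := [Choice of submodule_type by <:].
HB.instance Definition _ := [SubChoice_isSubLmodule of submodule_type by <:].

Lemma submodule_valP (x : submodule_type) : A (val x).
Proof. by have /asboolP := valP x. Qed.

Lemma submodule_val_onto x : A x -> exists y : submodule_type, val y = x.
Proof.
move=> Ax; have cx : x \in carrier sA by exact/asboolP.
by exists (SubmoduleElt cx).
Qed.

End SubmoduleAsModule.

(** * Sums and products of submodules *)

Section Sums.
Context (R : pzRingType) (M : lmodType R).
Implicit Types A B N L P : set M.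

Definition sum_set A B : set M := [set a + b | a in A & b in B].

Lemma sum_set_submodule A B :
  submodule A -> submodule B -> submodule (sum_set A B).
Proof.
move=> [A0 AZD] [B0 BZD]; split; first by exists 0 => //; exists 0; rewrite ?addr0.
move=> k _ _ [a Aa [b Bb <-]] [a' Aa' [b' Bb' <-]].
exists (k *: a + a'); first exact: AZD.
by exists (k *: b + b'); [exact: BZD|rewrite scalerDr addrACA].
Qed.

Lemma sum_set_fully_invariant A B :
  fully_invariant A -> fully_invariant B -> fully_invariant (sum_set A B).
Proof.
move=> [sA fA] [sB fB]; split; first exact: sum_set_submodule.
move=> f _ [_ [a Aa [b Bb <-]] <-]; exists (f a); first by apply: (fA f); exists a.
by exists (f b); [apply: (fB f); exists b|rewrite linearD].
Qed.

Lemma subset_sum_setl A B : submodule B -> A `<=` sum_set A B.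
Proof. by move=> [B0 _] a Aa; exists a => //; exists 0; rewrite ?addr0. Qed.

Lemma subset_sum_setr A B : submodule A -> B `<=` sum_set A B.
Proof. by move=> [A0 _] b Bb; exists 0 => //; exists b; rewrite ?add0r. Qed.

Lemma mprodS A A' B B' :
  A `<=` A' -> B `<=` B' -> mprod A B `<=` mprod A' B'.
Proof.
move=> AA' BB' x xAB C [sC A'B'C]; apply: xAB; split=> // _ [f fB [a Aa <-]].
apply: A'B'C; exists f; last by exists a => //; exact: AA'.
exact: subset_trans BB'.
Qed.

End Sums.

(** * Splitting a homomorphism into a sum of submodules *)

Section Lifting.
Context (R : pzRingType) (M : lmodType R) (A B : set M).
Context (sA : submodule A) (sB : submodule B).

Local Notation AB := (submodule_type sA * submodule_type sB)%type.

Definition pair_fun (x : AB) (b : bool) : M := if b then val x.1 else val x.2.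

Fact pair_fun_fin x : pair_fun x \in @fin_supp R M bool.
Proof. by apply/asboolP; exact: finite_finset. Qed.

Definition pair_embed (x : AB) : direct_sum M bool := DirectSum (pair_fun_fin x).

Fact pair_embed_linear : linear pair_embed.
Proof.
move=> k x y; apply: val_inj; apply/funext => b.
rewrite -[RHS]/(k *: pair_fun x b + pair_fun y b).
by case: b; exact: linearP.
Qed.

HB.instance Definition _ :=
  GRing.isLinear.Build R AB (direct_sum M bool) _ pair_embed pair_embed_linear.

Lemma pair_embed_inj : injective pair_embed.
Proof.
move=> [a b] [a' b'] /(congr1 val) /= E.
have /val_inj -> : val a = val a' := congr1 (@^~ true) E.
by have /val_inj -> : val b = val b' := congr1 (@^~ false) E.
Qed.

Lemma in_sigma_pair : in_sigma M AB.
Proof.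
exists bool, (direct_sum M bool), idfun, pair_embed; split; last exact: pair_embed_inj.
by move=> x _; exists x.
Qed.

Local Notation S := (submodule_type (sum_set_submodule sA sB)).

Fact add_in (x : AB) : val x.1 + val x.2 \in carrier (sum_set_submodule sA sB).
Proof.
apply/asboolP; exists (val x.1); first exact: submodule_valP.
by exists (val x.2) => //; exact: submodule_valP.
Qed.

Definition add_map (x : AB) : S := SubmoduleElt (add_in x).

Fact add_map_linear : linear add_map.
Proof.
move=> k x y; apply: val_inj.
rewrite -[RHS]/(k *: (val x.1 + val x.2) + (val y.1 + val y.2)).
by rewrite scalerDr addrACA; congr (_ + _); exact: linearP.
Qed.

HB.instance Definition _ := GRing.isLinear.Build R AB S _ add_map add_map_linear.

Lemma add_map_onto : set_surj setT setT add_map.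
Proof.
move=> x _; have [a Aa [b Bb abx]] := submodule_valP x.
have [[a' a'E] [b' b'E]] := (submodule_val_onto sA Aa, submodule_val_onto sB Bb).
by exists (a', b') => //; apply: val_inj; rewrite /= a'E b'E.
Qed.

Section Corestriction.
Context (f : {linear M -> M}) (fAB : range f `<=` sum_set A B).

Fact corestr_in x : f x \in carrier (sum_set_submodule sA sB).
Proof. by apply/asboolP; apply: fAB; exists x. Qed.

Definition corestr x : S := SubmoduleElt (corestr_in x).

Fact corestr_linear : linear corestr.
Proof. by move=> k x y; apply: val_inj; exact: linearP. Qed.

HB.instance Definition _ := GRing.isLinear.Build R M S _ corestr corestr_linear.

(** Projectivity of [M] lifts the corestriction of [f] to [A + B] along the
    addition map from [A x B]; the components of the lifting are [g] and [h]. *)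
Lemma range_sum_split : projective_in_sigma M ->
  exists g h : {linear M -> M},
    [/\ range g `<=` A, range h `<=` B & forall x, f x = g x + h x].
Proof.
move=> hM; have [beta betaE] := hM _ in_sigma_pair S add_map corestr add_map_onto.
exists (val \o fst \o beta), (val \o snd \o beta); split.
- by move=> _ [x _ <-]; exact: submodule_valP.
- by move=> _ [x _ <-]; exact: submodule_valP.
- by move=> x; exact: esym (congr1 val (betaE x)).
Qed.

End Corestriction.
End Lifting.

(** * Semiprime submodules are intersections of primes *)

Section PrimeIntersection.
Context (R : pzRingType) (M : lmodType R) (hM : projective_in_sigma M).
Implicit Types A B N L P : set M.

(** Modulo [P], a value [f (a + p)] is [f a], because [P] is fully invariant, and
    splitting [f] between [B] and [P] leaves only a term in [mprod A B]. *)
Lemma mprod_sum_sub A B P : fully_invariant A -> fully_invariant B ->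
  fully_invariant P -> mprod A B `<=` P ->
  mprod (sum_set A P) (sum_set B P) `<=` P.
Proof.
move=> [sA fA] [sB fB] [sP fP] ABP x; apply; split=> //.
move=> _ [f fBP [_ [a Aa [p Pp <-]] <-]].
have Padd u v : P u -> P v -> P (u + v).
  by move=> Pu Pv; rewrite -[u]scale1r; apply: sP.2.
rewrite linearD; apply: (Padd); last by apply: (fP f); exists p.
have [g [h [gB hP ->]]] := range_sum_split sB sP fBP hM.
apply: Padd; last by apply: hP; exists a.
by apply: ABP => C [_]; apply; exists g => //; exists a.
Qed.

Definition fi_gen (x : M) : set M := smallest (@fully_invariant R M) [set x].

Lemma fi_gen_id x : fi_gen x x.
Proof. by move=> A [_]; apply. Qed.

Lemma fi_gen_sub x A : fully_invariant A -> A x -> fi_gen x `<=` A.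
Proof. by move=> fA Ax y; apply; split=> // _ ->. Qed.

(** Both full invariance and avoiding [X] pass to unions of nonempty chains. *)
Lemma maximal_avoiding (X N : set M) : fully_invariant N -> N `&` X = set0 ->
  exists P, [/\ fully_invariant P, N `<=` P, P `&` X = set0 &
    forall Q, fully_invariant Q -> P `<=` Q -> Q `&` X = set0 -> Q `<=` P].
Proof.
move=> fN NX.
(* The empty chain has union [set0], which need not be admissible; adjoining [N]
   to every set makes its bound [N] itself. *)
pose good A := fully_invariant (A `|` N) /\ (A `|` N) `&` X = set0.
have [F Fgood totF|P [[fP PX] Pmax]] := @Zorn_bigcup M good.
  have [[N0 NZD] fiN] := fN; split; last first.
    apply/seteqP; split=> // x [[[A /Fgood[_ AX] Ax]|Nx] Xx].
      by rewrite -AX; split=> //; left.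
    by rewrite -NX.
  have inF A : F A -> A `|` N `<=` \bigcup_(B in F) B `|` N.
    by move=> FA x [Ax|Nx]; [left; exists A|right].
  split; first split; first by right.
    move=> k x y [[A FA Ax]|Nx] [[B FB By]|Ny].
    - have [AB|BA] := totF _ _ FA FB.
        apply: (inF _ FB); apply: (Fgood _ FB).1.1.2; left=> //; exact: AB.
      apply: (inF _ FA); apply: (Fgood _ FA).1.1.2; left=> //; exact: BA.
    - by apply: (inF _ FA); apply: (Fgood _ FA).1.1.2; [left|right].
    - by apply: (inF _ FB); apply: (Fgood _ FB).1.1.2; [right|left].
    - by right; exact: NZD.
  move=> f _ [x [[A FA Ax]|Nx] <-].
    by apply: (inF _ FA); apply: ((Fgood _ FA).1.2 f); exists x => //; left.
  by right; apply: (fiN f); exists x.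
exists (P `|` N); split=> // Q fQ PQ QX.
have QN : Q `|` N = Q.
  by apply/seteqP; split=> [x [//|Nx]|x Qx]; [apply: PQ; right|left].
move=> x Qx; left; apply: contrapT => nPx; apply: (Pmax Q); last first.
  by rewrite /good QN.
split; first by move=> y Py; apply: PQ; left.
by move=> QP; apply: nPx; exact: QP.
Qed.

(** The noncommutative form of the fact that a radical ideal is an intersection
    of primes: the sequence [s] below plays the role of the powers of an element,
    squaring being replaced by choosing an element outside [N] of the square of
    the generated submodule. *)
Lemma semiprime_prime_separation N x : semiprime_submodule N -> ~ N x ->
  exists2 P, prime_submodule P & N `<=` P /\ ~ P x.
Proof.
move=> [fN _ spN] nNx.
have /choice[g gP] : forall y, exists z, ~ N y ->
    mprod (fi_gen y) (fi_gen y) z /\ ~ N z.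
  move=> y; have [Ny|nNy] := pselect (N y); first by exists y.
  apply: contrapT => nz; apply: nNy; apply: (spN (fi_gen y) _ _ y (@fi_gen_id y)).
    exact: fully_invariant_smallest.
  move=> z yz; apply: contrapT => nNz; apply: nz.
  by exists z.
pose s n := iter n g x.
have sN n : ~ N (s n) by elim: n => [//|n /gP[]].
have sS n : mprod (fi_gen (s n)) (fi_gen (s n)) (s n.+1) := (gP _ (sN n)).1.
(* The generated submodules decrease along [s], so a fully invariant submodule
   that meets the sequence contains all of its later terms. *)
have s_fi A m n : fully_invariant A -> (m <= n)%N -> A (s m) -> A (s n).
  move=> fA /subnK <-; move: (n - m)%N => k Am.
  elim: k => [//|k Ak]; rewrite addSn.
  apply: (fi_gen_sub fA Ak); apply: (mprod_subl _ (sS _)).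
  exact: fully_invariant_smallest.
have [|P [fP NP Ps Pmax]] := @maximal_avoiding (range s) N fN.
  by apply/seteqP; split=> // y [Ny [n _ sny]]; apply: (sN n); rewrite sny.
have nPs n : ~ P (s n).
  by move=> Psn; suff : set0 (s n) by []; rewrite -Ps; split=> //; exists n.
exists P; last by split=> //; exact: (nPs 0%N).
split=> // [PT|A B fA fB ABP]; first by apply: (nPs 0%N); rewrite PT.
(* Maximality of [P], applied to [C + P]. *)
have meets C : fully_invariant C -> ~ C `<=` P -> exists n, sum_set C P (s n).
  move=> fC nCP; apply: contrapT => nC; apply: nCP.
  apply: (subset_trans (@subset_sum_setl _ _ C P fP.1)); apply: Pmax.
  - exact: sum_set_fully_invariant.
  - exact: subset_sum_setr fC.1.
  - by apply/seteqP; split=> // y [Cy [n _ sny]]; apply: nC; exists n; rewrite sny.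
have [|/(meets _ fA)[m Am]] := pselect (A `<=` P); first by left.
have [|/(meets _ fB)[n Bn]] := pselect (B `<=` P); first by right.
(* From index [maxn m n] on, the sequence lies in both [A + P] and [B + P], so
   its next term lies in their product, hence in [P]. *)
exfalso; apply: (nPs (maxn m n).+1).
apply: (mprod_sum_sub fA fB fP ABP); apply: (mprodS _ _ (sS _)).
  apply: fi_gen_sub; first exact: sum_set_fully_invariant.
  by apply: s_fi Am; [exact: sum_set_fully_invariant|exact: leq_maxl].
apply: fi_gen_sub; first exact: sum_set_fully_invariant.
by apply: s_fi Bn; [exact: sum_set_fully_invariant|exact: leq_maxr].
Qed.

End PrimeIntersection.

(** * The duality between SP(M) and closed sets of Spec(M) *)

Section HullKernel.
Context (R : pzRingType) (M : lmodType R).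
Implicit Types N L K : SP M.

Lemma Spec_prime (P : Spec M) : prime_submodule P.
Proof. exact: set_mem (valP P). Qed.

Lemma prime_SP (P : set M) : prime_submodule P -> SP_set P.
Proof. by move=> [fP PT pP]; right; split=> // L fL /(pP _ _ fL fL)[]. Qed.

Definition SP_of_prime (P : Spec M) : SP M :=
  MkSP (mem_set (prime_SP (Spec_prime P))).

Lemma Spec_VE N (P : Spec M) : Spec_V N P <-> (N <= SP_of_prime P)%O.
Proof. by split=> [NP|/SP_leP//]; apply/SP_leP. Qed.

Lemma SP_fi N : fully_invariant N.
Proof. by have /set_mem[->|[]] := valP N. Qed.

Lemma Spec_V_closed N : closed (Spec_V N : set (Spec M)).
Proof. by apply/Spec_closedP; exists N => //; exact: SP_fi. Qed.

(** Since primes belong to [SP M], a prime lies above [N] as soon as it lies above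
    the least member of [SP M] containing [N]. *)
Lemma closed_Spec_V (C : set (Spec M)) : closed C -> exists N, C = Spec_V N.
Proof.
move=> /Spec_closedP[N _ ->]; exists (MkSP (mem_set (SP_smallest N))).
apply/seteqP; split=> P; last first.
  by apply: subset_trans => x Nx A [_]; exact.
by move=> NP x; apply; split=> //; exact/prime_SP/Spec_prime.
Qed.

Lemma Spec_V_join N L : Spec_V (N `|` L)%O = Spec_V N `&` Spec_V L.
Proof.
apply/seteqP; split=> P; first by rewrite Spec_VE leUx => /andP[/SP_leP ? /SP_leP].
by move=> [/Spec_VE NP /Spec_VE LP]; rewrite Spec_VE leUx NP.
Qed.

(** A prime above [N `&` L] is above the product of [N] and [L], which is
    contained in both. *)
Lemma Spec_V_meet N L : Spec_V (N `&` L)%O = Spec_V N `|` Spec_V L.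
Proof.
apply/seteqP; split=> P; last by case=> NP x [] // Nx Lx; exact: NP.
move=> NLP; have [_ _] := Spec_prime P; apply; [exact: SP_fi..|].
move=> x NLx; apply: NLP; split; first exact: mprod_subl (SP_fi N) _ NLx.
exact: mprod_subr (SP_fi L).1 _ NLx.
Qed.

Lemma Spec_V_top : Spec_V (\top%O : SP M) = set0.
Proof.
apply/seteqP; split=> // P TP; have [_ + _] := Spec_prime P.
by apply; apply/seteqP; split.
Qed.

Lemma Spec_V_bot : Spec_V (\bot%O : SP M) = setT.
Proof. by apply/seteqP; split=> // P _; apply/Spec_VE; exact: le0x. Qed.

(** A member of [SP M] is recovered from its closed set as the intersection of the
    primes in it; for [setT] this is the empty intersection. *)
Lemma Spec_V_inj (hM : projective_in_sigma M) N L : Spec_V N = Spec_V L -> N = L.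
Proof.
suff le K K' : Spec_V K' `<=` Spec_V K -> (K <= K')%O.
  by move=> NL; apply/le_anti; rewrite !le // NL.
move=> VK; apply/SP_leP => x Kx; have /set_mem[->//|sK'] := valP K'.
apply: contrapT => /(semiprime_prime_separation hM sK')[P pP [K'P nPx]].
by apply: nPx; apply: (VK (MkSpec (mem_set pP))).
Qed.

End HullKernel.

Theorem corollary3p9 (R : pzRingType) (M : lmodType R)
    (hM : projective_in_sigma M) :
  normal_space (Spec M) <-> normal_frame (SP M).
Proof.
have topE (a b : SP M) : (a `|` b = \top)%O <-> Spec_V a `&` Spec_V b = set0.
  rewrite -Spec_V_join -(Spec_V_top M); split=> [->//|]; exact: Spec_V_inj.
have botE (a b : SP M) : (a `&` b = \bot)%O <-> Spec_V a `|` Spec_V b = setT.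
  rewrite -Spec_V_meet -(Spec_V_bot M); split=> [->//|]; exact: Spec_V_inj.
rewrite normal_space_openP; split=> [sep a b /topE ab|nF A B].
  have [U [V [oU oV aU bV UV]]] := sep _ _ (@Spec_V_closed _ _ a) (@Spec_V_closed _ _ b) ab.
  have [b' b'E] := closed_Spec_V (open_closedC oU).
  have [a' a'E] := closed_Spec_V (open_closedC oV).
  (* [Spec_V a'] is the complement of the neighbourhood of [Spec_V b], hence misses
     [Spec_V b]; symmetrically for [b'] and [a]. *)
  exists a', b'; split.
  - by apply/topE; rewrite -b'E; apply/disjoints_subset; rewrite setCK.
  - by apply/topE; rewrite setIC -a'E; apply/disjoints_subset; rewrite setCK.
  - by apply/botE; rewrite -a'E -b'E setUC -setCI UV setC0.
move=> /closed_Spec_V[a ->] /closed_Spec_V[b ->] /topE/nF[a' [b' [ab' a'b /botE ab0]]].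
exists (~` Spec_V b'), (~` Spec_V a'); split.
- exact/closed_openC/Spec_V_closed.
- exact/closed_openC/Spec_V_closed.
- by apply/disjoints_subset; exact/topE.
- by apply/disjoints_subset; rewrite setIC; exact/topE.
- by rewrite -setCU setUC ab0 setCT.
Qed.
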